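(* Let $3 \leqslant m \leqslant n$ and $k\geqslant 0$ be integers. If the complete bipartite graph $K_{m,n}$ has a $B_{k}^{m}$-EPG representation (an EPG representation in which every path is monotonic and has at most $k$ bends), then $$n(2m-k-2) \leqslant k(m-1)m + \frac{1}{2}m^2 + 2(k+1)m .$$
   Context: $K_{m,n}$ is the complete bipartite graph with partition classes of sizes $m$ and $n$. A grid consists of horizontal grid lines (rows, increasing from bottom to top) and vertical grid lines (columns, increasing from left to right). A grid point is a crossing of two grid lines. A grid edge is the part of a grid line between two consecutive grid points. A path on a grid consists of two grid points (its end points) and a number of consecutive grid edges connecting them. A bend of a path is a turn of the path at a grid point. An EPG representation of a graph $G$ assigns to each vertex $v$ of $G$ a path $P_v$ on a common grid such that two distinct vertices $v,w$ are adjacent in $G$ if and only if $P_v$ and $P_w$ share at least one grid edge. A path is monotonic if it is ascending in both columns and rows, i.e. it has the shape of a staircase going upwards from left to right. In the term ''$B_k^m$-EPG representation'' the superscript $m$ is just a symbol for ''monotonic'' and is unrelated to the integer $m$. *)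

(* Defs.v *)
From mathcomp Require Import all_boot.
Set Implicit Arguments.
Unset Strict Implicit.
Unset Printing Implicit Defensive.

(* The grid with c columns (numbered from left to right) and r rows (numbered
   from bottom to top); the pair (i, j) is the crossing of column i and row j. *)
Definition gpoint (c r : nat) : finType := ('I_c * 'I_r)%type.

Definition consecutive (i j : nat) : bool := (j == i.+1) || (i == j.+1).

Definition horizontal c r (a b : gpoint c r) : bool :=
  (a.2 == b.2) && consecutive a.1 b.1.

Definition vertical c r (a b : gpoint c r) : bool :=
  (a.1 == b.1) && consecutive a.2 b.2.

Definition grid_adj c r : rel (gpoint c r) :=
  fun a b => horizontal a b || vertical a b.

(* A path is given by the list of grid points it visits, from one end point to
   the other.  No simplicity condition is imposed: only monotonic paths are
   considered below, and these never revisit a grid point. *)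
Definition grid_path c r (p : seq (gpoint c r)) : bool :=
  if p is a :: q then path (@grid_adj c r) a q else false.

Definition ascending c r : rel (gpoint c r) :=
  fun a b => (a.1 <= b.1) && (a.2 <= b.2).

(* Grid paths are undirected (see [path_edges]); a monotonic path is listed
   from its lower left end point. *)
Definition monotonic c r (p : seq (gpoint c r)) : bool :=
  sorted (@ascending c r) p.

Fixpoint bends c r (p : seq (gpoint c r)) : nat :=
  if p is a :: q then
    (if q is b :: d :: _
     then (horizontal a b && vertical b d) || (vertical a b && horizontal b d)
     else false) + bends q
  else 0.

Definition path_edges c r (p : seq (gpoint c r)) : seq {set gpoint c r} :=
  [seq [set e.1; e.2] | e <- zip p (behead p)].

Definition share_edge c r (p q : seq (gpoint c r)) : bool :=
  has (fun e => e \in path_edges q) (path_edges p).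

Definition EPG_representation (V : finType) (adj : rel V) c r
    (P : V -> seq (gpoint c r)) : Prop :=
  (forall v, grid_path (P v)) /\
  (forall v w, v != w -> adj v w = share_edge (P v) (P w)).

Definition has_Bm_EPG_representation (k : nat) (V : finType) (adj : rel V) : Prop :=
  exists (c r : nat) (P : V -> seq (gpoint c r)),
    EPG_representation adj P /\
    (forall v, monotonic (P v) /\ bends (P v) <= k).

Definition complete_bipartite (m n : nat) : rel ('I_m + 'I_n)%type :=
  fun u v => match u, v with
             | inl _, inr _ | inr _, inl _ => true
             | _, _ => false
             end.
Arguments complete_bipartite m n : clear implicits.

(* Main.v *)
(* On a monotonic path, column + row increases by one at each step, so all paths
   can be parametrised by this common "time" s.
   Every path b of the n-side meets each of the m paths a, and each maximal
   overlap has a beginning and an end, giving at least 2mn overlap ends.  An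
   overlap end is the end of a segment of a (at most 2(k+1)m of these, each used
   by one b) or the end of a segment of b.  The latter contributes one overlap
   end for each of the two extremities and each of the k bends of b, unless both
   sides of a bend are overlap ends at which neither a-path ends a segment: then
   two a-paths cross at the bend.
   Two edge-disjoint staircases swap sides at each crossing, so the directions at
   successive crossings alternate and each path bends in between; hence they
   cross at most k times, or k+1 times if their first segments have different
   directions.  At most m^2/4 pairs are of the latter kind, and a crossing serves
   at most two paths b. *)
Require Import Defs.
From mathcomp Require Import all_boot all_order all_algebra zify lra.
Set Implicit Arguments.
Unset Strict Implicit.
Unset Printing Implicit Defensive.
Local Open Scope nat_scope.

(** * Staircases, overlaps and crossings *)

(* Only [col s] for [lo <= s <= hi] matters; at time [s] the path is in column
   [col s] and row [s - col s].  Its step [s] goes from time [s - 1] to [s]. *)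
Record staircase := Staircase { lo : nat; hi : nat; col : nat -> nat }.

Definition has_step (a : staircase) s := lo a < s <= hi a.
Definition is_staircase (a : staircase) :=
  lo a < hi a /\ forall s, has_step a s -> col a s.-1 <= col a s <= (col a s.-1).+1.
Definition goes_right (a : staircase) s := col a s.-1 != col a s.
Definition turn (a : staircase) s :=
  (lo a < s < hi a) && (goes_right a s != goes_right a s.+1).
(** Time is column plus row, so equal columns at equal times mean equal grid points; comparing
    columns suffices for a common edge. *)
Definition share (a b : staircase) s :=
  [&& has_step a s, has_step b s, col a s.-1 == col b s.-1 & col a s == col b s].
Definition overlap_begin a b s := share a b s.+1 && ~~ share a b s.
Definition overlap_end a b s := share a b s && ~~ share a b s.+1.
Definition segment_begin a s := (s == lo a) || turn a s.
Definition segment_end a s := (s == hi a) || turn a s.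
(** A transversal crossing: both paths run straight through an inner grid point, one horizontally
    and one vertically. Touching at a bend does not count. *)
Definition cross (a b : staircase) s :=
  [&& lo a < s < hi a, lo b < s < hi b, col a s == col b s,
      goes_right a s == goes_right a s.+1, goes_right b s == goes_right b s.+1
    & goes_right a s != goes_right b s].
Definition first_step (a : staircase) := goes_right a (lo a).+1.

Lemma goes_rightE a s : is_staircase a -> has_step a s ->
  col a s = col a s.-1 + goes_right a s.
Proof. by move=> [_ ha] /ha; rewrite /goes_right; case: eqP => /=; lia. Qed.

Lemma share_goes_right a b s : share a b s -> goes_right a s = goes_right b s.
Proof. by rewrite /goes_right => /and4P[_ _ /eqP-> /eqP->]. Qed.

Lemma segment_beginN a s : has_step a s.+1 -> ~~ segment_begin a s ->
  lo a < s < hi a /\ goes_right a s = goes_right a s.+1.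
Proof.
rewrite /has_step ltnS leq_eqVlt eq_sym /segment_begin negb_or => /andP[+ h].
by move=> + /andP[/negbTE ne]; rewrite ne /turn h => /= ->; rewrite negbK => /eqP.
Qed.

Lemma segment_endN a s : has_step a s -> ~~ segment_end a s ->
  lo a < s < hi a /\ goes_right a s = goes_right a s.+1.
Proof.
rewrite /has_step (leq_eqVlt s) /segment_end negb_or => /andP[h +].
by move=> + /andP[/negbTE ne]; rewrite ne /turn h => /= ->; rewrite negbK => /eqP.
Qed.

Lemma lt_has_step a s : lo a < s < hi a -> has_step a s /\ has_step a s.+1.
Proof. by move=> /andP[h h']; rewrite /has_step h h' ltnW // ltnW. Qed.

(** * Overlap ends are segment ends *)

(** Otherwise both paths run straight through time [s]; sharing step [s.+1], they have the same
    direction on step [s] too and would already share it. *)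
Lemma overlap_begin_segment a b s : is_staircase a -> is_staircase b ->
  overlap_begin a b s -> segment_begin a s || segment_begin b s.
Proof.
move=> sa sb /andP[sh]; apply: contraR; rewrite negb_or => /andP[na nb].
have gab := share_goes_right sh; case/and4P: sh => ea eb /eqP /= e _.
have [/lt_has_step[ea' _] ga] := segment_beginN ea na.
have [/lt_has_step[eb' _] gb] := segment_beginN eb nb.
rewrite /share ea' eb' e eqxx andbT /=.
by rewrite -(eqn_add2r (goes_right a s)) -goes_rightE // ga gab -gb -goes_rightE // e.
Qed.

Lemma overlap_end_segment a b s : is_staircase a -> is_staircase b ->
  overlap_end a b s -> segment_end a s || segment_end b s.
Proof.
move=> sa sb /andP[sh]; apply: contraR; rewrite negb_or => /andP[na nb].
have gab := share_goes_right sh; case/and4P: sh => ea eb _ /eqP e.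
have [/lt_has_step[_ ea'] ga] := segment_endN ea na.
have [/lt_has_step[_ eb'] gb] := segment_endN eb nb.
rewrite /share ea' eb' /= e eqxx /=.
by rewrite (goes_rightE sa ea') (goes_rightE sb eb') -ga -gb gab /= e.
Qed.

(** [b] arrives along [a2] and leaves along [a1], both of which go straight on; since [b] turns, one
    of them is horizontal and the other vertical. *)
Lemma cross_at_turn a1 a2 b s : turn b s ->
  overlap_begin a1 b s -> ~~ segment_begin a1 s ->
  overlap_end a2 b s -> ~~ segment_end a2 s -> cross a1 a2 s.
Proof.
move=> /andP[_ tb] /andP[sh1 _] n1 /andP[sh2 _] n2.
have g1 := share_goes_right sh1; have g2 := share_goes_right sh2.
case/and4P: sh1 => p1 _ /eqP /= p3 _; case/and4P: sh2 => q1 _ _ /eqP q4.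
have [r1 t1] := segment_beginN p1 n1; have [r2 t2] := segment_endN q1 n2.
by rewrite /cross r1 r2 p3 q4 t1 -t2 g1 g2 !eqxx eq_sym tb.
Qed.

(** * Crossings of two edge-disjoint staircases *)

(* Each change of [f] forces [w] to agree with [f]; so, apart from the first
   one, changes of [f] are separated by changes of [w]. *)
Lemma changes_le (w f : nat -> bool) p r : p <= r ->
  (forall s, p <= s < r -> f s != f s.+1 -> w s.+1 = f s.+1) ->
  \sum_(p <= s < r) (f s != f s.+1) + (w r != f r) <=
  \sum_(p <= s < r) (w s != w s.+1) + (w p != f p).
Proof.
elim: r => [|r IH].
  by rewrite leqn0 => /eqP-> _; rewrite !big_geq.
rewrite leq_eqVlt => /orP[/eqP->|lepr] H; first by rewrite !big_geq.
rewrite ltnS in lepr; rewrite !big_nat_recr //=.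
have {}IH := IH lepr (fun s h => H s ltac:(lia)).
have := H r ltac:(lia); move: IH.
set X := \sum_(_ <= _ < _) _; set Y := \sum_(_ <= _ < _) _.
case: (f r) (f r.+1) (w r) (w r.+1) (w p) (f p) => [] [] [] [] [] [] //=; lia.
Qed.

(* Step [s] of [a] lies to the right of step [s] of [b]; comparing the sums of
   the two columns decides this also when the steps have a common end point. *)
Definition side a b s := col b s.-1 + col b s < col a s.-1 + col a s.

(** The horizontal path comes from the left of the vertical one and leaves to its right. *)
Lemma cross_side a b s : is_staircase a -> is_staircase b ->
  cross a b s -> side a b s != side a b s.+1.
Proof.
move=> sa sb /and5P[/lt_has_step[p p'] /lt_has_step[q q'] /eqP e /eqP ga].
move=> /andP[/eqP gb gab]; have ea := goes_rightE sa p; have eb := goes_rightE sb q.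
rewrite /side /= (goes_rightE sa p') (goes_rightE sb q') /= -ga -gb.
move: gab e ea eb; move: (col a s) (col b s) (col a s.-1) (col b s.-1) => x y u v.
by case: (goes_right a s); case: (goes_right b s) => //= _; lia.
Qed.

(** The column difference changes by at most one per step and no step is shared, so a change of side
    forces a meeting at time [s]. From there one path goes right and the other up, and the former is
    then on the right. *)
Lemma side_change a b s : is_staircase a -> is_staircase b ->
  (forall t, ~~ share a b t) -> lo a < s < hi a -> lo b < s < hi b ->
  side a b s != side a b s.+1 ->
  goes_right a s.+1 = side a b s.+1 /\ goes_right b s.+1 = ~~ side a b s.+1.
Proof.
move=> sa sb ns /lt_has_step[p p'] /lt_has_step[q q'].
have := ns s; have := ns s.+1; rewrite /share p p' q q' /side /=.
rewrite (goes_rightE sa p') (goes_rightE sb q') /= (goes_rightE sa p) (goes_rightE sb q).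
move: (col a s.-1) (col b s.-1) => x y.
case: (goes_right a s); case: (goes_right b s); case: (goes_right a s.+1);
  case: (goes_right b s.+1); rewrite ?addn0 ?addn1; lia.
Qed.

Lemma sum_nat_support (F : nat -> nat) p r N : p <= r <= N ->
  (forall s, ~~ (p <= s < r) -> F s = 0) ->
  \sum_(0 <= s < N) F s = \sum_(p <= s < r) F s.
Proof.
move=> /andP[pr rN] F0; rewrite (big_cat_nat (leq0n r) rN) (big_cat_nat (leq0n p) pr) /=.
rewrite [X in X + _ + _]big_nat big1 ?[X in _ + X]big_nat ?[X in _ + X]big1 ?addn0 //.
  by move=> s h; apply: F0; lia.
by move=> s h; apply: F0; lia.
Qed.

Lemma leq_sum_subrange (F : nat -> nat) p r N : p <= r <= N ->
  \sum_(p <= s < r) F s <= \sum_(0 <= s < N) F s.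
Proof.
move=> /andP[pr rN]; rewrite (big_cat_nat (leq0n r) rN) (big_cat_nat (leq0n p) pr) /=.
by rewrite -addnA addnCA leq_addr.
Qed.

(** Stated once for both paths: [w] is the direction of [a] with [c] false, or that of [b] with [c]
    true, where the side is negated. [p] is the start of the path chosen, and the last term is the
    mismatch at the beginning that [changes_le] allows. *)
Lemma sum_cross_le_changes a b N c w p : is_staircase a -> is_staircase b ->
  (forall t, ~~ share a b t) -> hi a < N -> p <= maxn (lo a) (lo b) ->
  (forall s, lo a < s < hi a -> lo b < s < hi b ->
     side a b s != side a b s.+1 -> w s.+1 = c (+) side a b s.+1) ->
  \sum_(0 <= s < N) cross a b s <=
    \sum_(p.+1 <= s < minn (hi a) (hi b)) (w s != w s.+1)
    + (w p.+1 != c (+) side a b (maxn (lo a) (lo b)).+1).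
Proof.
set P := maxn _ _; set Q := minn _ _ => sa sb ns hN leP hw.
have [ltPQ|leQP] := ltnP P Q; last first.
  rewrite big1 // => s _; case: (boolP (cross _ _ _)) => // /and3P[]; lia.
(* [P.+1] is the first common step; freezing [f] before it ensures that no change of [f] occurs
   earlier. *)
pose f s := c (+) side a b (maxn s P.+1).
have fE s : P < s -> f s = c (+) side a b s.
  by move=> Ps; rewrite /f; congr (c (+) side a b _); lia.
have f0 s : s <= P.+1 -> f s = c (+) side a b P.+1.
  by move=> Ps; rewrite /f; congr (c (+) side a b _); lia.
have pQ : p.+1 <= Q by lia.
have H : forall s, p.+1 <= s < Q -> f s != f s.+1 -> w s.+1 = f s.+1.
  move=> s ps; have [leSP|ltPs] := leqP s P; first by rewrite !f0 ?eqxx //; lia.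
  rewrite !fE; [move=> h|lia|lia]; apply: hw; [lia|lia|].
  by move: h; case: (c); case: (side a b s); case: (side a b s.+1).
have := changes_le pQ H; rewrite (f0 p.+1); last by lia.
apply: leq_trans; apply: leq_trans (leq_addr _ _).
rewrite (@sum_nat_support _ p.+1 Q); last first.
- by move=> s h; case: (boolP (cross _ _ _)) => // /and3P[]; lia.
- by lia.
apply: leq_sum => s _; case: (boolP (cross _ _ _)) => // h.
have := cross_side sa sb h; case/and3P: h => *.
rewrite !fE; lia.
Qed.

Lemma sum_changes_le_turns a q N : q <= hi a -> hi a < N ->
  \sum_((lo a).+1 <= s < q) (goes_right a s != goes_right a s.+1) <=
  \sum_(0 <= s < N) turn a s.
Proof.
move=> qa aN; have [lq|ql] := leqP (lo a).+1 q; last by rewrite big_geq // ltnW.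
apply: leq_trans (@leq_sum_subrange _ (lo a).+1 q N _); last by lia.
rewrite !big_nat; apply: leq_sum => s h; rewrite /turn.
by rewrite (_ : lo a < s < hi a); last by lia.
Qed.

(** Each path bounds the crossings by its turns plus its initial mismatch. The mismatches refer to
    opposite sides, so if the first steps agree, exactly one of them vanishes and that path gives
    the bound [k]. *)
Lemma sum_cross_le a b N k : is_staircase a -> is_staircase b ->
  (forall t, ~~ share a b t) -> hi a < N -> hi b < N ->
  \sum_(0 <= s < N) turn a s <= k -> \sum_(0 <= s < N) turn b s <= k ->
  \sum_(0 <= s < N) cross a b s <= k + (first_step a != first_step b).
Proof.
move=> sa sb ns aN bN ka kb.
have h1 := @sum_cross_le_changes a b N false (goes_right a) (lo a) sa sb ns aN
  (leq_maxl _ _) (fun s u v h => proj1 (side_change sa sb ns u v h)).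
have h2 := @sum_cross_le_changes a b N true (goes_right b) (lo b) sa sb ns aN
  (leq_maxr _ _) (fun s u v h => proj2 (side_change sa sb ns u v h)).
have h3 := sum_changes_le_turns (geq_minl (hi a) (hi b)) aN.
have h4 := sum_changes_le_turns (geq_minr (hi a) (hi b)) bN.
have {}h1 := leq_trans h1 (leq_add (leq_trans h3 ka) (leqnn _)).
have {}h2 := leq_trans h2 (leq_add (leq_trans h4 kb) (leqnn _)).
rewrite -!/(first_step _) in h1 h2.
move: h1 h2; set S := \sum_(_ <= _ < _) _.
case: (side _ _ _) (first_step a) (first_step b) => [] [] [] //=; lia.
Qed.

(** * Elementary counting and existence of overlap ends *)

Lemma sum_bool_le1 (T : finType) (Q : pred T) (c : bool) :
  (forall i, Q i -> c) -> (forall i j, Q i -> Q j -> i = j) ->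
  \sum_i Q i <= c.
Proof.
move=> Qc Qu; case: (pickP Q) => [i Qi|Q0]; last by rewrite big1 // => i _; rewrite Q0.
rewrite (Qc i Qi) (bigD1 i) //= Qi big1 // => j ji.
by case: (boolP (Q j)) => // Qj; rewrite (Qu _ _ Qi Qj) eqxx in ji.
Qed.

Lemma sum_const (T : finType) (c : nat) : \sum_(i : T) c = #|T| * c.
Proof. exact: sum_nat_const. Qed.

Lemma sum_bool_ex (T : finType) (Q : pred T) : 0 < \sum_i Q i -> exists i, Q i.
Proof.
case: (pickP Q) => [i Qi|Q0]; first by exists i.
by rewrite big1 // => i _; rewrite Q0.
Qed.

Lemma sum_eq_le1 N x : \sum_(0 <= s < N) (s == x) <= 1.
Proof.
elim: N => [|N IH]; first by rewrite big_geq.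
rewrite big_nat_recr //=; have [->|] := eqVneq N x; last by lia.
by rewrite big_nat big1 // => s h; apply/eqP; rewrite eqb0; lia.
Qed.

Lemma sum_nat_ge1 (F : nat -> bool) s N : s < N -> F s -> 1 <= \sum_(0 <= s < N) F s.
Proof.
by move=> sN Fs; rewrite (bigD1_seq s) ?iota_uniq ?mem_index_iota //= Fs.
Qed.

Lemma overlap_begin_exists a b N s : hi a < N -> share a b s ->
  1 <= \sum_(0 <= s < N) overlap_begin a b s.
Proof.
move=> aN sh; have ex : exists s, share a b s by exists s.
case: (ex_minnP ex) => -[|t] ht tmin; first by move: ht => /andP[]; rewrite /has_step; lia.
apply: (@sum_nat_ge1 _ t); first by case/andP: ht; rewrite /has_step; lia.
by rewrite /overlap_begin ht; apply/negP => /tmin; lia.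
Qed.

Lemma overlap_end_exists a b N s : hi a < N -> share a b s ->
  1 <= \sum_(0 <= s < N) overlap_end a b s.
Proof.
move=> aN sh; have ex : exists s, share a b s by exists s.
have bd t : share a b t -> t <= hi a by case/andP; rewrite /has_step; lia.
case: (ex_maxnP ex bd) => t ht tmax.
apply: (@sum_nat_ge1 _ t); first by have := bd _ ht; lia.
by rewrite /overlap_end ht; apply/negP => /tmax; lia.
Qed.

(** * Double counting of overlap ends *)

Lemma share_trans a b c s : share a b s -> share a c s -> share b c s.
Proof. by rewrite /share; lia. Qed.

Lemma shareC a b s : share a b s = share b a s.
Proof. by rewrite /share; lia. Qed.

(** Such overlap ends lie at bends or extremities of [b], and at most one begins and one ends at
    each time. Each extremity and each bend pays for one; a bend carrying two is a crossing by
    [cross_at_turn], which pays for the second. The factor [share (A i) b s.+1] ties that crossing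
    to [b]. *)
Lemma unmatched_ends_le (I : finType) (A : I -> staircase) b N k :
  (forall i, is_staircase (A i)) -> is_staircase b ->
  (forall i j s, share (A i) b s -> share (A j) b s -> i = j) ->
  \sum_(0 <= s < N) turn b s <= k ->
  \sum_(0 <= s < N) \sum_i
     ((overlap_begin (A i) b s && ~~ segment_begin (A i) s) +
      (overlap_end (A i) b s && ~~ segment_end (A i) s)) <=
  k + 2 + \sum_(0 <= s < N) \sum_i \sum_j (cross (A i) (A j) s && share (A i) b s.+1).
Proof.
move=> sA sb uA kb.
(* The bound [k + 2] is spread over the turns, [lo b] and [hi b], so that the comparison can be made
   time by time. *)
have := leq_add (leq_add kb (sum_eq_le1 N (lo b))) (sum_eq_le1 N (hi b)).
rewrite -addnA -(leq_add2r (\sum_(0 <= s < N) \sum_i \sum_j (cross (A i) (A j) s && share (A i) b s.+1))).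
rewrite -[k + 1 + 1]addnA.
apply: leq_trans; rewrite -!big_split /=; apply: leq_sum => s _; rewrite big_split /=.
set u := \sum_i _; set v := \sum_i _; set X := \sum_i _.
have hu : u <= segment_begin b s.
  apply: sum_bool_le1 => [i /andP[h n]|i j /andP[/andP[h _] _] /andP[/andP[h' _] _]].
    by have := overlap_begin_segment (sA i) sb h; rewrite (negbTE n).
  exact: uA h h'.
have hv : v <= segment_end b s.
  apply: sum_bool_le1 => [i /andP[h n]|i j /andP[/andP[h _] _] /andP[/andP[h' _] _]].
    by have := overlap_end_segment (sA i) sb h; rewrite (negbTE n).
  exact: uA h h'.
have hX : turn b s -> 0 < u -> 0 < v -> 0 < X.
  move=> tb /sum_bool_ex[i /andP[h n]] /sum_bool_ex[j /andP[h' n']].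
  rewrite /X (bigD1 i) //= (bigD1 j) //=.
  by rewrite (cross_at_turn tb h n h' n'); case/andP: h => ->.
by move: hu hv hX; rewrite /segment_begin /segment_end; case: (turn b s);
  case: (s == lo b); case: (s == hi b) => /=; lia.
Qed.

(** There are [2 * #|d| * (#|I| - #|d|)] such ordered pairs; the bound is the inequality of
    arithmetic and geometric means. *)
Lemma sum_neq_le (I : finType) (d : I -> bool) :
  2 * \sum_i \sum_j (d i != d j) <= #|I| ^ 2.
Proof.
have E i : \sum_j (d i != d j) = if d i then #|I| - #|d| else #|d|.
  have -> : #|I| - #|d| = #|[predC d]| by rewrite -(cardC d) addKn.
  by case: (d i); rewrite -sum1_card [RHS]big_mkcond; apply: eq_bigr => j _;
    rewrite ?inE unfold_in; case: (d j).
rewrite (eq_bigr _ (fun i _ => E i)) (bigID d) /=.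
rewrite (eq_bigr (fun _ => #|I| - #|d|)); last by move=> i ->.
rewrite [X in _ + X](eq_bigr (fun _ => #|d|)); last by move=> i /negbTE ->.
rewrite !sum_nat_const -[#|[pred i | ~~ d i]|]/(#|[predC d]|) -(cardC d).
by rewrite addKn [X in _ * (_ + X)]mulnC addnn -mul2n mulnA nat_AGM2.
Qed.

(** The final count, doubled to clear the half and with [2 * k * #|I|] moved to the left to avoid
    truncated subtraction. *)
Lemma staircases_bound (I J : finType) (A : I -> staircase) (B : J -> staircase) k :
  (forall i, is_staircase (A i)) -> (forall j, is_staircase (B j)) ->
  (forall i i' s, share (A i) (A i') s -> i = i') ->
  (forall j j' s, share (B j) (B j') s -> j = j') ->
  (forall i j, exists s, share (A i) (B j) s) ->
  (forall i N, \sum_(0 <= s < N) turn (A i) s <= k) ->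
  (forall j N, \sum_(0 <= s < N) turn (B j) s <= k) ->
  4 * #|I| * #|J| + 2 * k * #|I| <=
  2 * #|J| * (k + 2) + 4 * (k + 1) * #|I| + 2 * k * #|I| ^ 2 + #|I| ^ 2.
Proof.
move=> sA sB uA uB sAB kA kB.
pose N := (\max_i hi (A i)).+1.
have hN i : hi (A i) < N by rewrite ltnS; apply: (leq_bigmax i).
have uAb j i i' s : share (A i) (B j) s -> share (A i') (B j) s -> i = i'.
  by rewrite ![share _ (B j) _]shareC => h h'; apply: uA (share_trans h h').
pose beg i j s := overlap_begin (A i) (B j) s.
pose fin i j s := overlap_end (A i) (B j) s.
have total : 2 * (#|I| * #|J|) <= \sum_j \sum_(0 <= s < N) \sum_i (beg i j s + fin i j s).
  rewrite (eq_bigr (fun j => \sum_i \sum_(0 <= s < N) (beg i j s + fin i j s)));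
    last by move=> j _; rewrite exchange_big.
  rewrite [leqRHS]exchange_big /=.
  have -> : 2 * (#|I| * #|J|) = \sum_(i : I) \sum_(j : J) 2.
    by rewrite !sum_const; lia.
  apply: leq_sum => i _; apply: leq_sum => j _; rewrite big_split /=.
  have [s sh] := sAB i j.
  have := leq_add (overlap_begin_exists (hN i) sh) (overlap_end_exists (hN i) sh); exact.
(* Each [A i] has at most [k + 1] segment beginnings and as many ends, each used by at most one
   [B j] because the [B j] are edge-disjoint. *)
have matched : \sum_j \sum_(0 <= s < N) \sum_i
    ((beg i j s && segment_begin (A i) s) + (fin i j s && segment_end (A i) s))
    <= 2 * (k + 1) * #|I|.
  rewrite exchange_big /= (eq_bigr (fun s => \sum_i \sum_j
    ((beg i j s && segment_begin (A i) s) + (fin i j s && segment_end (A i) s)))); last first.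
    by move=> s _; rewrite exchange_big.
  rewrite exchange_big /= mulnC -sum_const; apply: leq_sum => i _.
  have := leq_add (leq_add (kA i N) (sum_eq_le1 N (lo (A i))))
                  (leq_add (kA i N) (sum_eq_le1 N (hi (A i)))).
  rewrite -!big_split /= (_ : 2 * (k + 1) = k + 1 + (k + 1)); last by lia.
  apply: leq_trans; apply: leq_sum => s _; rewrite big_split /=.
  apply: (@leq_trans (segment_begin (A i) s + segment_end (A i) s)); last first.
    by rewrite /segment_begin /segment_end; case: turn; do 2 case: (s == _).
  apply: leq_add; apply: sum_bool_le1 => [j /andP[]//|j j'].
    by move=> /andP[/andP[h _] _] /andP[/andP[h' _] _]; apply: uB (share_trans h h').
  by move=> /andP[/andP[h _] _] /andP[/andP[h' _] _]; apply: uB (share_trans h h').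
have unmatched := @leq_sum _ (index_enum J) xpredT _ _ (fun j _ =>
  @unmatched_ends_le I A (B j) N k sA (sB j) (@uAb j) (kB j N)).
(* Step [s.+1] of [A i] belongs to at most one [B j], so each crossing of an ordered pair is charged
   at most once. *)
have crossings : \sum_j \sum_(0 <= s < N) \sum_i \sum_i'
    (cross (A i) (A i') s && share (A i) (B j) s.+1)
    <= \sum_i \sum_i' \sum_(0 <= s < N) cross (A i) (A i') s.
  rewrite exchange_big /= (eq_bigr (fun s => \sum_i \sum_i' \sum_j
    (cross (A i) (A i') s && share (A i) (B j) s.+1))); last first.
    move=> s _; rewrite exchange_big; apply: eq_bigr => i _; exact: exchange_big.
  rewrite exchange_big; apply: leq_sum => i _; rewrite exchange_big; apply: leq_sum => i' _.
  apply: leq_sum => s _; apply: sum_bool_le1 => [j /andP[]//|j j'].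
  by move=> /andP[_ h] /andP[_ h']; apply: uB (share_trans h h').
(* No path crosses itself, so each diagonal pair saves [k]; this is the term [k * #|I|]. *)
have cross_pair : \sum_i \sum_i' \sum_(0 <= s < N) cross (A i) (A i') s + k * #|I|
    <= k * #|I| ^ 2 + \sum_i \sum_i' (first_step (A i) != first_step (A i')).
  have -> : k * #|I| = \sum_(i : I) \sum_i' (k * (i == i')).
    rewrite mulnC -sum_const; apply: eq_bigr => i _.
    rewrite (bigD1 i) //= eqxx muln1 big1 ?addn0 // => j /negbTE.
    by rewrite eq_sym => ->; rewrite muln0.
  have -> : k * #|I| ^ 2 = \sum_(i : I) \sum_(i' : I) k by rewrite !sum_const; lia.
  rewrite -!big_split; apply: leq_sum => i _; rewrite -!big_split; apply: leq_sum => i' _ /=.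
  have [<-|ne] := eqVneq i i'.
    by rewrite big1 ?muln1 ?leq_addr // => s _; rewrite /cross !eqxx !andbF.
  rewrite muln0 addn0; apply: sum_cross_le => //.
  by move=> t; apply: contraNN ne => /uA->.
have := sum_neq_le (fun i => first_step (A i)).
move: total matched unmatched crossings cross_pair; rewrite big_split /= sum_const.
rewrite (_ : \sum_j \sum_(0 <= s < N) \sum_i (beg i j s + fin i j s) =
  \sum_j \sum_(0 <= s < N) \sum_i
    ((beg i j s && segment_begin (A i) s) + (fin i j s && segment_end (A i) s)) +
  \sum_j \sum_(0 <= s < N) \sum_i
    ((beg i j s && ~~ segment_begin (A i) s) + (fin i j s && ~~ segment_end (A i) s))).
  rewrite /beg /fin.
  set X1 := \sum_j _; set X2 := \sum_j _; set X3 := \sum_j _; set X4 := \sum_i _; set X5 := \sum_i _.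
  clearbody X1 X2 X3 X4 X5; rewrite -!mulnn; move: #|I| #|J| => p q; clear; lia.
rewrite -big_split; apply: eq_bigr => j _; rewrite -big_split; apply: eq_bigr => s _.
rewrite -big_split; apply: eq_bigr => i _ /=.
by case: (beg _ _ _); case: (fin _ _ _); case: segment_begin; case: segment_end.
Qed.

(** * From monotonic grid paths to staircases *)

Definition level c r (a : gpoint c r) : nat := a.1 + a.2.

(** The level grows by one per step of a monotonic path, so its point at time [s] is entry
    [s - level a] of the list. *)
Definition staircase_of c r (p : seq (gpoint c r)) : staircase :=
  if p is a :: q
  then Staircase (level a) (level a + size q) (fun s => (nth a p (s - level a)).1)
  else Staircase 0 0 (fun=> 0).

Lemma gpoint_eq c r (a b : gpoint c r) :
  level a = level b -> a.1 = b.1 :> nat -> a = b.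
Proof.
case: a b => [a1 a2] [b1 b2]; rewrite /level /= => e1 e2.
by congr (_, _); apply: val_inj => /=; lia.
Qed.

Lemma grid_step c r (a b : gpoint c r) : grid_adj a b -> ascending a b ->
  [/\ level b = (level a).+1, a.1 <= b.1 <= a.1.+1,
      horizontal a b = (a.1 != b.1 :> nat) & vertical a b = (a.1 == b.1 :> nat)].
Proof.
case: a b => [a1 a2] [b1 b2].
rewrite /grid_adj /ascending /horizontal /vertical /consecutive /level /=.
rewrite -!(inj_eq val_inj) /=; move: (a1 : nat) (a2 : nat) (b1 : nat) (b2 : nat).
by move=> {a1 a2 b1 b2} *; split; lia.
Qed.

Lemma path_step c r (a : gpoint c r) q i :
  grid_path (a :: q) -> monotonic (a :: q) -> i < size q ->
  grid_adj (nth a (a :: q) i) (nth a q i) /\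
  ascending (nth a (a :: q) i) (nth a q i).
Proof. by move=> /(pathP a) h1 /(pathP a) h2 hi; split; [apply: h1|apply: h2]. Qed.

Lemma path_level c r (a : gpoint c r) q i :
  grid_path (a :: q) -> monotonic (a :: q) -> i <= size q ->
  level (nth a (a :: q) i) = level a + i.
Proof.
move=> gp mp; elim: i => [|i IH] hi; first by rewrite addn0.
have [h1 h2] := path_step gp mp hi.
by have [-> _ _ _] := grid_step h1 h2; rewrite IH ?addnS // ltnW.
Qed.

Lemma path_edges_nth c r (a : gpoint c r) q i : i < size q ->
  nth set0 (path_edges (a :: q)) i = [set nth a (a :: q) i; nth a q i].
Proof.
move=> hi; have sz : size (zip (a :: q) q) = size q by rewrite size_zip /=; lia.
by rewrite (nth_map (a, a)) /= ?sz // nth_zip_cond sz hi.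
Qed.

Lemma size_path_edges c r (a : gpoint c r) q : size (path_edges (a :: q)) = size q.
Proof. by rewrite size_map size_zip /=; lia. Qed.

Definition step_ends c r (p : seq (gpoint c r)) s (u v : gpoint c r) :=
  [/\ has_step (staircase_of p) s, (level u).+1 = s, level v = s,
      u.1 = col (staircase_of p) s.-1 :> nat & v.1 = col (staircase_of p) s :> nat].

Lemma step_endsP c r (p : seq (gpoint c r)) s : grid_path p -> monotonic p ->
  has_step (staircase_of p) s ->
  exists u v, step_ends p s u v /\ [set u; v] \in path_edges p.
Proof.
case: p => [|a q] // gp mp hs; have := hs; rewrite /has_step /= => /andP[h1 h2].
have [i def_s] : exists i, s = level a + i.+1 by exists (s - level a).-1; lia.
have hi : i < size q by move: h2; rewrite def_s leq_add2l.
exists (nth a (a :: q) i), (nth a q i); split; last first.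
  by rewrite -path_edges_nth // mem_nth // size_path_edges.
split => //=; rewrite ?(path_level gp mp (ltnW hi)) ?(path_level gp mp hi) /=.
- by lia.
- by [].
- by rewrite (_ : s.-1 - level a = i) //; lia.
- by rewrite (_ : s - level a = i.+1) //; lia.
Qed.

Lemma path_edges_step_ends c r (p : seq (gpoint c r)) e :
  grid_path p -> monotonic p -> e \in path_edges p ->
  exists s u v, step_ends p s u v /\ e = [set u; v].
Proof.
case: p => [|a q] // gp mp /(nthP set0)[i].
rewrite size_path_edges => hi; rewrite path_edges_nth // => <-.
exists (level a + i.+1), (nth a (a :: q) i), (nth a q i); split => //.
split => //=; rewrite ?(path_level gp mp (ltnW hi)) /=.
- by rewrite /has_step /= leq_add2l hi andbT addnS ltnS leq_addr.
- by lia.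
- by rewrite -[nth a q i]/(nth a (a :: q) i.+1) path_level.
- by rewrite (_ : (level a + i.+1).-1 - level a = i) //; lia.
- by rewrite (_ : level a + i.+1 - level a = i.+1) //; lia.
Qed.

(** Edges are unordered sets; the levels tell the lower end from the upper one. *)
Lemma eq_edge c r (u v u' v' : gpoint c r) :
  level v = (level u).+1 -> level v' = (level u').+1 ->
  [set u; v] = [set u'; v'] -> u = u' /\ v = v'.
Proof.
move=> h h' E.
have : u \in [set u'; v'] by rewrite -E set21.
have : v \in [set u'; v'] by rewrite -E set22.
have : u' \in [set u; v] by rewrite E set21.
by case/set2P=> e1 /set2P[] e2 /set2P[] e3; subst; split => //; lia.
Qed.

(** The levels of its ends fix the time of an edge, so two paths using it do so at the same step. *)
Lemma share_edgeP c r (p q : seq (gpoint c r)) :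
  grid_path p -> monotonic p -> grid_path q -> monotonic q ->
  share_edge p q <-> exists s, share (staircase_of p) (staircase_of q) s.
Proof.
move=> gp mp gq mq; split=> [/hasP[e ep eq]|[s /and4P[hp hq /eqP e1 /eqP e2]]].
  have [s [u [v [[hs ls ls' cu cv] Ee]]]] := path_edges_step_ends gp mp ep.
  have [t [w [z [[ht lt lt' cw cz] Ee']]]] := path_edges_step_ends gq mq eq.
  have [Eu Ev] : u = w /\ v = z by apply: eq_edge; rewrite -?Ee //; lia.
  have ts : t = s by rewrite -ls -lt Eu.
  rewrite {}ts -Eu -Ev in ht cw cz; exists s.
  by rewrite /share hs ht -cu -cv -cw -cz !eqxx.
have [u [v [[_ ls ls' cu cv] ep]]] := step_endsP gp mp hp.
have [w [z [[_ lt lt' cw cz] eq]]] := step_endsP gq mq hq.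
apply/hasP; exists [set u; v] => //.
have -> : u = w by apply: gpoint_eq; lia.
by have -> : v = z by apply: gpoint_eq; lia.
Qed.

Lemma staircase_ofP c r (p : seq (gpoint c r)) : grid_path p -> monotonic p ->
  1 < size p -> is_staircase (staircase_of p).
Proof.
case: p => [|a q] // gp mp sz; split=> [|s]; first by rewrite /= -[ltnLHS]addn0 ltn_add2l.
rewrite /has_step /= => /andP[h1 h2].
have [i def_s] : exists i, s = level a + i.+1 by exists (s - level a).-1; lia.
have hi : i < size q by move: h2; rewrite def_s leq_add2l.
have [g1 g2] := path_step gp mp hi; have [_ + _ _] := grid_step g1 g2.
by rewrite def_s addnS /= addKn -addnS addKn.
Qed.

Lemma size_share_edge c r (p q : seq (gpoint c r)) : share_edge p q -> 1 < size p.
Proof. by case: p => [|a [|b p]]. Qed.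

Lemma bendsE c r (x : gpoint c r) p :
  bends p = \sum_(0 <= i < (size p).-2)
    (let: (a, b, d) := (nth x p i, nth x p i.+1, nth x p i.+2) in
     (horizontal a b && vertical b d) || (vertical a b && horizontal b d)).
Proof.
elim: p => [|a [|b [|d p]] IH]; try by rewrite big_geq.
by rewrite big_nat_recl // -IH.
Qed.

Lemma sum_turn_le_bends c r (p : seq (gpoint c r)) N :
  grid_path p -> monotonic p ->
  \sum_(0 <= s < N) turn (staircase_of p) s <= bends p.
Proof.
case: p => [|a q] // gp mp; set A := staircase_of _.
have [q0|q_gt0] := posnP (size q).
  by rewrite big1 // => s _; rewrite /turn /A /= q0; case: (boolP (_ < _ < _)) => //; lia.
apply: leq_trans (@leq_sum_subrange _ 0 N (maxn N (hi A)) _) _; first by lia.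
rewrite (@sum_nat_support _ (lo A).+1 (hi A)); last first.
- by move=> s h; rewrite /turn (negbTE h).
- by rewrite leq_maxr andbT /A /= -addn1 leq_add2l.
(* The shift matches time [i + (level a).+1] with the middle point of the [i]-th triple of the
   list. *)
rewrite (bendsE a) -{1}[(lo A).+1]add0n big_addn /A /=.
rewrite subnS addKn.
rewrite !big_nat; apply: leq_sum => i hi.
have hi1 : i.+1 < size q by rewrite -(prednK q_gt0) ltnS.
rewrite /turn /goes_right /=.
have [g1 g2] := path_step gp mp (ltnW hi1).
have [g3 g4] := path_step gp mp hi1.
have [_ _ -> ->] := grid_step g1 g2; have [_ _ -> ->] := grid_step g3 g4.
rewrite (_ : (i + (level a).+1).-1 - level a = i); last by lia.
rewrite (_ : i + (level a).+1 - level a = i.+1); last by lia.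
rewrite (_ : (i + (level a).+1).+1 - level a = i.+2); last by lia.
by rewrite /=; do 2 case: (_ == _ :> nat); case: (_ < _ < _).
Qed.

(** * The bound for the complete bipartite graph *)

Import Order.TTheory GRing.Theory Num.Theory.
Local Open Scope ring_scope.

Theorem lemma2p5 (m n k : nat) (hm : (3 <= m)%N) (hmn : (m <= n)%N)
  (hrep : has_Bm_EPG_representation k (complete_bipartite m n)) :
  n%:R * (2 * m%:R - k%:R - 2) <=
    k%:R * (m%:R - 1) * m%:R + 1 / 2 * m%:R ^+ 2 + 2 * (k%:R + 1) * m%:R :> rat.
Proof.
case: hrep => c [r [P [[gP adjP] mbP]]].
have mP v : monotonic (P v) by case: (mbP v).
have shareP v w : v != w ->
    complete_bipartite m n v w <->
    exists s, share (staircase_of (P v)) (staircase_of (P w)) s.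
  by move=> vw; rewrite adjP //; apply: share_edgeP.
have stP v : is_staircase (staircase_of (P v)).
  (* Every vertex has a neighbour, here the one of index 2 in the other class, so its path contains
     an edge. *)
  have [w vw] : exists w, complete_bipartite m n v w.
    by case: v => i; [exists (inr (Ordinal (leq_trans hm hmn)))|exists (inl (Ordinal hm))].
  apply: staircase_ofP => //; apply: (@size_share_edge _ _ _ (P w)).
  by rewrite -adjP //; case: v w vw => [i|i] [j|j].
have turnP v N : (\sum_(0 <= s < N) turn (staircase_of (P v)) s <= k)%N.
  by apply: leq_trans (sum_turn_le_bends _ _ _) _ => //; case: (mbP v).
have := @staircases_bound 'I_m 'I_n (fun i => staircase_of (P (inl i)))
  (fun j => staircase_of (P (inr j))) k.
rewrite !card_ord => /(_ (fun=> stP _) (fun=> stP _)) H.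
have {}H : (4 * m * n + 2 * k * m <=
  2 * n * (k + 2) + 4 * (k + 1) * m + 2 * k * m ^ 2 + m ^ 2)%N.
  (* Vertices of one class are not adjacent, so their paths are edge-disjoint. *)
  apply: H => // [i i' s h|j j' s h|i j]; last by apply/shareP.
    have [//|ne] := eqVneq i i'.
    by have : complete_bipartite m n (inl i) (inl i') by apply/shareP => //; exists s.
  have [//|ne] := eqVneq j j'.
  by have : complete_bipartite m n (inr j) (inr j') by apply/shareP => //; exists s.
(* Over the rationals [H] is twice the goal, up to rearrangement. *)
move: H; rewrite -(ler_nat rat) !(natrD, natrM).
by move: (m%:R) (n%:R) (k%:R) => x y z; lra.
Qed.
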